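(* There does not exist a strongly co-edge-regular graph with parameters $(n,k,2,\ell)$ which contains an induced quadrangle (induced $4$-cycle) and satisfies $\frac{3k}{4}\leqslant\ell\leqslant k-3$.
   Context: All graphs are finite, undirected and simple. A co-edge-regular graph with parameters $(n,k,c)$ is a $k$-regular graph on $n$ vertices, neither complete nor edgeless, in which any two distinct non-adjacent vertices have exactly $c$ common neighbours. For adjacent $x,y$, $a_{xy}$ is the number of common neighbours of $x,y$. A strongly co-edge-regular graph with parameters $(n,k,c,\ell)$ is a co-edge-regular graph with parameters $(n,k,c)$ such that for any two distinct non-adjacent vertices $x,z$, $\sum_{y\sim x,\,y\sim z}a_{xy}=\ell$. *)

(* Defs.v *)
From mathcomp Require Import all_boot.

Set Implicit Arguments.
Unset Strict Implicit.
Unset Printing Implicit Defensive.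

Record sgraph := SGraph {
  vertex :> finType;
  adj : rel vertex;
  adj_sym : symmetric adj;
  adj_irrefl : irreflexive adj
}.

Definition nbhd (G : sgraph) (x : G) : {set G} := [set y | adj x y].

Definition common_nbhd (G : sgraph) (x y : G) : {set G} := nbhd x :&: nbhd y.

Definition regular (G : sgraph) (k : nat) : Prop :=
  forall x : G, #|nbhd x| = k.

Definition complete (G : sgraph) : Prop := forall x y : G, x != y -> adj x y.

Definition edgeless (G : sgraph) : Prop := forall x y : G, ~~ adj x y.

Definition co_edge_regular (G : sgraph) (n k c : nat) : Prop :=
  [/\ #|G| = n, regular G k, ~ complete G, ~ edgeless G
    & forall x z : G, x != z -> ~~ adj x z -> #|common_nbhd x z| = c].

(* In the sum y is adjacent to x, so #|common_nbhd x y| is a_{xy}. *)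
Definition strongly_co_edge_regular (G : sgraph) (n k c l : nat) : Prop :=
  co_edge_regular G n k c /\
  forall x z : G, x != z -> ~~ adj x z ->
    \sum_(y in common_nbhd x z) #|common_nbhd x y| = l.

Definition has_induced_quadrangle (G : sgraph) : Prop :=
  exists w x y z : G,
    [/\ uniq [:: w; x; y; z],
        [&& adj w x, adj x y, adj y z & adj z w],
        ~~ adj w y & ~~ adj x z].

(* Main.v *)
Require Import Defs.
From mathcomp Require Import all_boot.
From mathcomp Require Import zify.

Set Implicit Arguments.
Unset Strict Implicit.
Unset Printing Implicit Defensive.

(** Work in the local graph of a vertex [x] (the graph induced on its [k]
    neighbours), where [y] has degree [a x y].  Two non-adjacent vertices of it
    have at most one common neighbour there; if they have none we call
    [(x, y1, y2)] a corner: then [x, y1, y2] lie in an induced quadrangle and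
    [a x y1 + a x y2 = l].  As [l <= k - 3], some [u] adjacent to [x] is
    adjacent to neither [y1] nor [y2].  Inclusion-exclusion in the local graphs
    together with [4 l >= 3 k] shows that [u] is joined to [y1] by a vertex [w]
    and to [y2] by a vertex [w'] inside the local graph of [x], that [a x u] is
    small and [a w u] is large, that [w] and [w'] are adjacent, and that [w] is
    adjacent to all other common neighbours of [x] and [y1].  Let [z] be the
    vertex opposite to [x] and [q <> y1] the second common neighbour of [w] and
    [z].  If [q] is not adjacent to [y1], the corner [(w, y1, q)] contradicts
    the largeness of [a w u]; otherwise [a w y1 = a x y2] exceeds [a x y1].
    Exchanging [y1] and [y2] gives the opposite strict inequality. *)

Lemma leq_card_setU3 (T : finType) (A B C : {set T}) :
  #|A| + #|B| + #|C| <=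
    #|A :|: B :|: C| + #|A :&: B| + #|A :&: C| + #|B :&: C|.
Proof.
have := cardsUI A B; have := cardsUI (A :|: B) C.
have := (leq_card_setU (A :&: C) (B :&: C)).1; rewrite -setIUl; lia.
Qed.

(** * Non-adjacent pairs and their two common neighbours *)

Section CoEdgeRegular.

Variables (G : sgraph) (k l : nat).
Hypothesis deg_k : regular G k.
Hypothesis common2 :
  forall x z : G, x != z -> ~~ adj x z -> #|common_nbhd x z| = 2.
Hypothesis common_sum : forall x z : G, x != z -> ~~ adj x z ->
  \sum_(y in common_nbhd x z) #|common_nbhd x y| = l.

Local Notation a x y := #|@common_nbhd G x y|.

Lemma in_common (x y z : G) : (z \in common_nbhd x y) = adj x z && adj y z.
Proof. by rewrite !inE. Qed.

Lemma common_nbhdC (x y : G) : common_nbhd x y = common_nbhd y x.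
Proof. by rewrite /common_nbhd setIC. Qed.

Lemma adj_neq (x y : G) : adj x y -> x != y.
Proof. by apply: contraTneq => ->; rewrite adj_irrefl. Qed.

Lemma adj_sep (x y z : G) : adj x y -> ~~ adj x z -> y != z.
Proof. by move=> xy; apply: contraNneq => <-. Qed.

Lemma common_pair (p q b c : G) : p != q -> ~~ adj p q -> b != c ->
  adj p b -> adj q b -> adj p c -> adj q c -> common_nbhd p q = [set b; c].
Proof.
move=> pq npq bc pb qb pc qc; apply/esym/eqP.
rewrite eqEcard (common2 pq npq) cards2 bc andbT.
by apply/subsetP=> t /set2P[]->; rewrite in_common ?pb ?pc.
Qed.

Lemma common_third (p q b c d : G) : p != q -> ~~ adj p q -> b != c ->
  adj p b -> adj q b -> adj p c -> adj q c -> adj p d -> adj q d ->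
  d = b \/ d = c.
Proof.
move=> pq npq bc pb qb pc qc pd qd; apply/set2P.
by rewrite -(common_pair pq npq bc) // in_common pd.
Qed.

Lemma common_other (p q b : G) : p != q -> ~~ adj p q -> adj p b -> adj q b ->
  exists c, [/\ c != b, adj p c & adj q c].
Proof.
move=> pq npq pb qb; have := common2 pq npq.
rewrite (cardsD1 b) in_common pb qb => -[E].
have /card_gt0P[c] : 0 < #|common_nbhd p q :\ b| by lia.
by rewrite in_setD1 in_common => /and3P[]; exists c.
Qed.

Lemma common_pair_sum (p q b c : G) : p != q -> ~~ adj p q -> b != c ->
  adj p b -> adj q b -> adj p c -> adj q c -> a p b + a p c = l.
Proof.
move=> pq npq bc pb qb pc qc; rewrite -(common_sum pq npq).
by rewrite (common_pair pq npq bc) // big_setU1 ?inE //= big_set1.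
Qed.

(** * Closed neighbourhoods in the local graph of [x], and their overlaps *)

Definition local_ball (x y : G) : {set G} := y |: common_nbhd x y.

Lemma card_local_ball (x y : G) : #|local_ball x y| = (a x y).+1.
Proof. by rewrite cardsU1 in_common adj_irrefl andbF. Qed.

Lemma local_ball_sub (x y : G) : adj x y -> local_ball x y \subset nbhd x.
Proof.
by move=> xy; apply/subsetP=> t /setU1P[->|]; rewrite !inE // => /andP[].
Qed.

Lemma local_ballI (x y z : G) : y != z -> ~~ adj y z ->
  local_ball x y :&: local_ball x z \subset
    [set t | [&& adj x t, adj y t & adj z t]].
Proof.
move=> yz nyz; apply/subsetP=> t; rewrite !inE.
case/andP=> /predU1P[->|/andP[xt yt]] /predU1P[E|/andP[xt' zt]].
- by rewrite E eqxx in yz.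
- by rewrite adj_sym zt in nyz.
- by rewrite E in yt; rewrite yt in nyz.
- by rewrite xt yt.
Qed.

(** One of the two common neighbours of [y] and [z] is [x] itself, which leaves at most one in the
    local graph. *)
Lemma card_local_ballI (x y z : G) : adj x y -> adj x z -> y != z ->
  ~~ adj y z -> #|local_ball x y :&: local_ball x z| <= 1.
Proof.
move=> xy xz yz nyz; have := common2 yz nyz.
rewrite (cardsD1 x) in_common adj_sym xy adj_sym xz /= => -[<-].
apply/subset_leq_card/(subset_trans (local_ballI x yz nyz)).
apply/subsetP=> t; rewrite !inE => /and3P[xt -> ->].
by rewrite eq_sym (adj_neq xt).
Qed.

Lemma local_pair_bound (x y z : G) : adj x y -> adj x z -> y != z ->
  ~~ adj y z -> a x y + a x z + 1 <= k.
Proof.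
move=> xy xz yz nyz; have := card_local_ballI xy xz yz nyz.
have := cardsUI (local_ball x y) (local_ball x z); rewrite !card_local_ball.
have : #|local_ball x y :|: local_ball x z| <= k.
  by rewrite -(deg_k x) subset_leq_card // subUset !local_ball_sub.
lia.
Qed.

Lemma local_triple_bound (x y z t : G) : adj x y -> adj x z -> adj x t ->
  a x y + a x z + a x t + 3 <= k + #|local_ball x y :&: local_ball x z|
    + #|local_ball x y :&: local_ball x t|
    + #|local_ball x z :&: local_ball x t|.
Proof.
move=> xy xz xt.
have := leq_card_setU3 (local_ball x y) (local_ball x z) (local_ball x t).
rewrite !card_local_ball.
have : #|local_ball x y :|: local_ball x z :|: local_ball x t| <= k.
  by rewrite -(deg_k x) subset_leq_card // 2!subUset !local_ball_sub.
lia.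
Qed.

(** * Corners and links in the local graph *)

Definition corner (x y1 y2 : G) :=
  [&& adj x y1, adj x y2, y1 != y2, ~~ adj y1 y2
    & [forall t, ~~ [&& adj x t, adj y1 t & adj y2 t]]].

Lemma cornerC (x y1 y2 : G) : corner x y1 y2 = corner x y2 y1.
Proof.
rewrite /corner eq_sym [adj y1 y2]adj_sym andbCA; congr [&& _, _, _, _ & _].
by apply: eq_forallb => t; rewrite [adj y1 t && _]andbC.
Qed.

Lemma corner_sep (x y1 y2 t : G) : corner x y1 y2 -> adj x t -> adj y1 t ->
  ~~ adj y2 t.
Proof.
case/and5P=> _ _ _ _ /forallP/(_ t) H xt y1t.
by rewrite xt y1t in H.
Qed.

Lemma corner_or_link (x y z : G) : adj x y -> adj x z -> y != z -> ~~ adj y z ->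
  corner x y z \/ exists w, [/\ adj x w, adj y w & adj z w].
Proof.
move=> xy xz yz nyz; rewrite /corner xy xz yz nyz /=.
case: (boolP [forall t, _]) => [|/forallPn[w]]; first by left.
by rewrite negbK => /and3P[xw yw zw]; right; exists w.
Qed.

Lemma corner_local_ballI (x y1 y2 : G) : corner x y1 y2 ->
  #|local_ball x y1 :&: local_ball x y2| = 0.
Proof.
case/and5P=> _ _ yy nyy /forallP no_link; apply: eq_card0 => t.
apply/negP=> /(subsetP (local_ballI x yy nyy)); rewrite inE.
exact/negP.
Qed.

(** Take the common neighbour of [y1] and [y2] other than [x]; adjacent to [x], it would link [y1]
    to [y2]. *)
Lemma corner_opposite (x y1 y2 : G) : corner x y1 y2 ->
  exists z, [/\ x != z, ~~ adj x z, adj y1 z & adj y2 z].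
Proof.
move=> c; have /and5P[xy1 xy2 yy nyy _] := c.
have [||z [zx y1z y2z]] := @common_other y1 y2 x yy nyy; rewrite 1?adj_sym //.
exists z; rewrite eq_sym; split=> //; apply: contraTN y2z => xz.
exact: corner_sep c xz y1z.
Qed.

Lemma corner_sum (x y1 y2 : G) : corner x y1 y2 -> a x y1 + a x y2 = l.
Proof.
move=> c; have [z [xz nxz y1z y2z]] := corner_opposite c.
have /and5P[xy1 xy2 yy _ _] := c.
by apply: (@common_pair_sum x z); rewrite // adj_sym.
Qed.

(** The two common neighbours of [y] and [u] are [x] and [w], so the sum condition applies at
    [y]. *)
Lemma link_sum (x y u w : G) : adj x y -> adj x u -> y != u -> ~~ adj y u ->
  adj x w -> adj y w -> adj u w -> a x y + a w y = l.
Proof.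
move=> xy xu yu nyu xw yw uw; rewrite common_nbhdC [common_nbhd w y]common_nbhdC.
by apply: (@common_pair_sum y u); rewrite // 1?adj_sym // (adj_neq xw).
Qed.

(** * Vertices far from a corner, and the resulting bounds *)

Hypothesis l_ge : 3 * k <= 4 * l.

(* If [w] links [u] to [y] but [u] is not linked to [y'], then
   [a x u = a x y] and [a w u = a w y = a x y']: the bounds in the local graphs
   of [x] and [w] are then incompatible with [4 l >= 3 k]. *)
Lemma far_links (x y1 y2 u : G) : corner x y1 y2 -> adj x u -> u != y1 ->
    u != y2 -> ~~ adj y1 u -> ~~ adj y2 u ->
  [/\ exists w, [/\ adj x w, adj y1 w & adj u w],
      exists w, [/\ adj x w, adj y2 w & adj u w] & a x u + l + 1 <= k].
Proof.
have half (y y' w : G) : corner x y y' -> corner x y' u -> adj x u -> u != y ->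
    ~~ adj y u -> [/\ adj x w, adj y w & adj u w] -> False.
  move=> c c' xu uy nyu [xw yw uw]; rewrite eq_sym in uy.
  have /and5P[xy _ _ _ _] := c.
  have s1 := corner_sum c; have s2 := corner_sum c'.
  have s3 := link_sum xy xu uy nyu xw yw uw.
  have s4 : a x u + a w u = l.
    by apply: (@link_sum _ _ y); rewrite // 1?eq_sym // adj_sym.
  have := @local_pair_bound w y u; rewrite ![adj w _]adj_sym.
  move=> /(_ yw uw uy nyu) s5.
  have := local_triple_bound xy (proj1 (andP (proj2 (andP c)))) xu.
  have := card_local_ballI xy xu uy nyu.
  rewrite (corner_local_ballI c) (corner_local_ballI c').
  by move: s1 s2 s3 s4 s5 l_ge; clear; lia.
move=> c xu uy1 uy2 ny1u ny2u; have /and5P[xy1 xy2 yy nyy _] := c.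
have s1 := corner_sum c.
have y1u : y1 != u by rewrite eq_sym.
have y2u : y2 != u by rewrite eq_sym.
have T := local_triple_bound xy1 xy2 xu; rewrite (corner_local_ballI c) in T.
case: (corner_or_link xy1 xu y1u ny1u) => [c1|L1];
  case: (corner_or_link xy2 xu y2u ny2u) => [c2|L2].
(* Three corners make the balls disjoint and the three degrees add up to [3 * l / 2], which exceeds
   [k - 3]. *)
- have s2 := corner_sum c1; have s3 := corner_sum c2.
  rewrite (corner_local_ballI c1) (corner_local_ballI c2) in T. exfalso.
  by move: s1 s2 s3 T l_ge; clear; lia.
- have [w L] := L2; rewrite cornerC in c.
  by case: (half _ _ _ c c1 xu uy2 ny2u L).
- by have [w L] := L1; case: (half _ _ _ c c2 xu uy1 ny1u L).
(* The ball of [u] overlaps each of the other two at most once, so [l + a x u + 3 <= k + 2]. *)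
split=> //; have := card_local_ballI xy1 xu y1u ny1u.
by have := card_local_ballI xy2 xu y2u ny2u; move: s1 T; clear; lia.
Qed.

Hypothesis l_le : l + 3 <= k.

(** The two disjoint balls have [l + 2 < k] elements together. *)
Lemma corner_far (x y1 y2 : G) : corner x y1 y2 ->
  exists u, [/\ adj x u, u != y1, u != y2, ~~ adj y1 u & ~~ adj y2 u].
Proof.
move=> c; have /and5P[xy1 xy2 _ _ _] := c.
have [u] : exists u, u \in nbhd x :\: (local_ball x y1 :|: local_ball x y2).
  have /setIidPr E : local_ball x y1 :|: local_ball x y2 \subset nbhd x.
    by rewrite subUset !local_ball_sub.
  apply/set0Pn; rewrite -card_gt0 cardsD E deg_k.
  have := cardsUI (local_ball x y1) (local_ball x y2).
  rewrite !card_local_ball (corner_local_ballI c); have := corner_sum c.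
  by move: l_le; clear; lia.
rewrite !inE => /andP[+ xu]; rewrite xu /= !negb_or.
by case/andP=> /andP[? ?] /andP[? ?]; exists u.
Qed.

(** For a far vertex [u] linked to [y1] by [w], [a w y1 = a x y2] and [a w u >= 2 * l + 1 - k]; both
    enter the pair bound in the local graph of [w]. *)
Lemma corner_le (x y1 y2 : G) : corner x y1 y2 -> a x y2 + 2 * l + 2 <= 2 * k.
Proof.
move=> c; have [u [xu uy1 uy2 ny1u ny2u]] := corner_far c.
have [[w [xw y1w uw]] _ u_le] := far_links c xu uy1 uy2 ny1u ny2u.
have /and5P[xy1 xy2 yy nyy _] := c.
rewrite eq_sym in uy1.
have s3 := link_sum xy1 xu uy1 ny1u xw y1w uw.
have s4 : a x u + a w u = l.
  by apply: (@link_sum _ _ y1); rewrite // 1?eq_sym // adj_sym.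
have := @local_pair_bound w y1 u; rewrite ![adj w _]adj_sym.
move=> /(_ y1w uw uy1 ny1u); have := corner_sum c.
by move: s3 s4 u_le; clear; lia.
Qed.

Lemma corner_ge (x y1 y2 : G) : corner x y1 y2 -> 3 * l + 2 <= a x y1 + 2 * k.
Proof. by move=> c; have := corner_le c; have := corner_sum c; lia. Qed.

Lemma far_link_sum (x y1 y2 u w : G) : corner x y1 y2 -> adj x u -> u != y1 ->
    u != y2 -> ~~ adj y1 u -> ~~ adj y2 u -> adj x w -> adj y1 w -> adj u w ->
  a w y1 = a x y2 /\ 2 * l + 1 <= a w u + k.
Proof.
move=> c xu uy1 uy2 ny1u ny2u xw y1w uw.
have /and5P[xy1 _ _ _ _] := c.
have [_ _ u_le] := far_links c xu uy1 uy2 ny1u ny2u.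
have s : a x u + a w u = l by apply: (@link_sum _ _ y1); rewrite // adj_sym.
rewrite eq_sym in uy1.
have := link_sum xy1 xu uy1 ny1u xw y1w uw; have := corner_sum c.
by move: s u_le; clear; lia.
Qed.

Lemma far_link_uniq (x y u w t : G) : adj x y -> adj x u -> u != y ->
    ~~ adj y u -> adj x w -> adj y w -> adj u w -> adj x t -> adj y t ->
  adj u t -> t = w.
Proof.
move=> xy xu uy nyu xw yw uw xt yt ut; rewrite eq_sym in uy.
have [||E|//] := @common_third y u x w t uy nyu (adj_neq xw) _ _ yw uw yt ut;
  rewrite 1?adj_sym //.
by rewrite E adj_irrefl in xt.
Qed.

(** * A far vertex [u] with its links [w] to [y1] and [w'] to [y2] *)

Section Far.

Variables (x y1 y2 u w w' : G).
Hypothesis c : corner x y1 y2.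
Hypothesis xu : adj x u.
Hypothesis uy1 : u != y1.
Hypothesis uy2 : u != y2.
Hypothesis ny1u : ~~ adj y1 u.
Hypothesis ny2u : ~~ adj y2 u.
Hypothesis xw : adj x w.
Hypothesis y1w : adj y1 w.
Hypothesis uw : adj u w.
Hypothesis xw' : adj x w'.
Hypothesis y2w' : adj y2 w'.
Hypothesis uw' : adj u w'.

Let xy1 : adj x y1. Proof. by have /and5P[] := c. Qed.
Let xy2 : adj x y2. Proof. by have /and5P[] := c. Qed.

Lemma links_neq : w != w'.
Proof. by apply: contraNneq (corner_sep c xw y1w) => ->. Qed.

(* Both [a u w] and [a u w'] exceed [k / 2], so [w] and [w'] have two common
   neighbours in the local graph of [u]. *)
Lemma far_second :
  exists v, [/\ v != x, adj u v, adj w v & adj w' v].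
Proof.
have [_ hw] := far_link_sum c xu uy1 uy2 ny1u ny2u xw y1w uw.
have c' : corner x y2 y1 by rewrite cornerC.
have [_ hw'] := far_link_sum c' xu uy2 uy1 ny2u ny1u xw' y2w' uw'.
have := cardsUI (common_nbhd u w) (common_nbhd u w').
rewrite [common_nbhd u w]common_nbhdC [common_nbhd u w']common_nbhdC.
have : #|common_nbhd w u :|: common_nbhd w' u| <= k.
  by rewrite -(deg_k u) subset_leq_card // subUset !subsetIr.
rewrite [X in _ -> _ + X = _ -> _](cardsD1 x) => s1 s2.
have : 0 < #|common_nbhd w u :&: common_nbhd w' u :\ x|.
  by move: s1 s2 hw hw' l_ge; case: (x \in _) => /=; clear; lia.
case/card_gt0P=> v; rewrite in_setD1 in_setI !in_common.
by case/and3P=> vx /andP[wv uv] /andP[w'v _]; exists v.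
Qed.

(** Otherwise [x], [u] and [v] would be three common neighbours of [w] and [w']. *)
Lemma links_adj : adj w w'.
Proof.
have [v [vx uv wv w'v]] := far_second; apply/negPn/negP=> nww'.
have := @common_third w w' x u v links_neq nww' (adj_neq xu).
rewrite ![adj _ x]adj_sym ![adj _ u]adj_sym.
case=> // E; first by rewrite E eqxx in vx.
by rewrite E adj_irrefl in uv.
Qed.

(** The vertex [v] of [far_second] is adjacent to [x], since [w], [w'] and [u] are three common
    neighbours; uniqueness of links then keeps it away from [y1] and [y2]. *)
Lemma second_far :
  exists v, [/\ v != u, adj w v, adj x v
    & [/\ v != y1, v != y2, ~~ adj y1 v & ~~ adj y2 v]].
Proof.
have [v [vx uv wv w'v]] := far_second; exists v.
have vu : v != u by rewrite eq_sym adj_neq.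
have xv : adj x v.
  apply/negPn/negP=> nxv; rewrite eq_sym in vx.
  have := @common_third x v w w' u vx nxv links_neq.
  rewrite ![adj v _]adj_sym => -[] // E; first by move: uw; rewrite E adj_irrefl.
  by move: uw'; rewrite E adj_irrefl.
have ny1v : ~~ adj y1 v.
  apply/negP=> y1v.
  have E := far_link_uniq xy1 xu uy1 ny1u xw y1w uw xv y1v uv.
  by rewrite E adj_irrefl in wv.
have ny2v : ~~ adj y2 v.
  apply/negP=> y2v.
  have E := far_link_uniq xy2 xu uy2 ny2u xw' y2w' uw' xv y2v uv.
  by rewrite E adj_irrefl in w'v.
split=> //; split=> //.
- by apply: contraNneq ny1u => <-; rewrite adj_sym.
- by apply: contraNneq ny2u => <-; rewrite adj_sym.
Qed.

(* Otherwise [w], [v] and [y2] are pairwise non-adjacent with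
   [a x w = a x v = a x y1], too much for the local graph of [x]. *)
Lemma link_dominates (v : G) : adj x v -> adj y1 v -> v != w -> adj v w.
Proof.
move=> xv y1v vw; apply/negPn/negP=> nvw.
have [aw hw] := far_link_sum c xu uy1 uy2 ny1u ny2u xw y1w uw.
have [_ _ u_le] := far_links c xu uy1 uy2 ny1u ny2u.
have nuv : ~~ adj u v.
  apply/negP=> uv; have E := far_link_uniq xy1 xu uy1 ny1u xw y1w uw xv y1v uv.
  by rewrite E eqxx in vw.
have vu : u != v by apply: contraNneq ny1u => ->.
have ny2v := corner_sep c xv y1v.
have ny2w := corner_sep c xw y1w.
(* A corner [(x, u, v)] would give [a x u >= 3 * l + 2 - 2 * k], against [a x u + l + 1 <= k]. *)
have [c'|[t [xt ut vt]]] := corner_or_link xu xv vu nuv.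
  by have := corner_ge c'; move: u_le l_ge; clear; lia.
have ny1t : ~~ adj y1 t.
  apply/negP=> y1t; have E := far_link_uniq xy1 xu uy1 ny1u xw y1w uw xt y1t ut.
  by rewrite E (negPf nvw) in vt.
have ny2t : ~~ adj y2 t.
  (* Then [t = w'], and both [w] and [v] link [y1] to [w'], so they coincide. *)
  apply/negP=> y2t; have E := far_link_uniq xy2 xu uy2 ny2u xw' y2w' uw' xt y2t ut.
  have w'y1 : w' != y1 by rewrite -E; apply: contraNneq ny1u => <-; rewrite adj_sym.
  have := @far_link_uniq x y1 w' w v xy1 xw' w'y1.
  rewrite -E => /(_ ny1t xw y1w); rewrite {1}E adj_sym links_adj.
  by move=> /(_ isT xv y1v); rewrite adj_sym => /(_ vt) E'; rewrite E' eqxx in vw.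
have ty1 : t != y1 by apply: contraNneq ny1u => <-; rewrite adj_sym.
have ty2 : t != y2 by apply: contraNneq ny2u => <-; rewrite adj_sym.
have tv : adj t v by rewrite adj_sym.
have [av hv] := far_link_sum c xt ty1 ty2 ny1t ny2t xv y1v tv.
have vy1 : adj v y1 by rewrite adj_sym.
have wy1 : adj w y1 by rewrite adj_sym.
have sv := link_sum xv xw vw nvw xy1 vy1 wy1.
have wv : w != v by rewrite eq_sym.
have nwv : ~~ adj w v by rewrite adj_sym.
have sw := link_sum xw xv wv nwv xy1 wy1 vy1.
rewrite common_nbhdC in aw; rewrite common_nbhdC in av.
have := corner_sum c; have := corner_ge c.
have T := local_triple_bound xv xw xy2.
have vy2 : v != y2.
  by apply: contraTneq y1v => ->; case/and5P: c.
have wy2 : w != y2.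
  by apply: contraTneq y1w => ->; case/and5P: c.
rewrite adj_sym in ny2v; rewrite adj_sym in ny2w.
have := card_local_ballI xv xw vw nvw.
have := card_local_ballI xv xy2 vy2 ny2v.
have := card_local_ballI xw xy2 wy2 ny2w.
by move: T aw av sv sw l_ge; clear; lia.
Qed.

Lemma corner_lt : a x y1 < a x y2.
Proof.
have [z [xz nxz y1z y2z]] := corner_opposite c.
have /and5P[_ _ yy nyy _] := c.
have xz_common t : adj x t -> adj z t -> t = y1 \/ t = y2.
  by move=> xt zt; apply: (@common_third x z); rewrite // adj_sym.
have [aw _] := far_link_sum c xu uy1 uy2 ny1u ny2u xw y1w uw.
have ny2w := corner_sep c xw y1w.
have nwz : ~~ adj w z.
  apply/negP; rewrite adj_sym => zw; case: (xz_common w xw zw) => E.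
    by move: y1w; rewrite E adj_irrefl.
  by move: y1w; rewrite E (negPf nyy).
have wz : w != z by apply: contraNneq nxz => <-.
have wy1 : adj w y1 by rewrite adj_sym.
have zy1 : adj z y1 by rewrite adj_sym.
have [q [qy1 wq zq]] := common_other wz nwz wy1 zy1.
have xq : x != q by apply: contraNneq nxz => ->; rewrite adj_sym.
have [y1q|ny1q] := boolP (adj y1 q).
  have nxq : ~~ adj x q.
    apply/negP=> xaq; case: (xz_common q xaq zq) => E.
      by rewrite E eqxx in qy1.
    by rewrite -E y1q in nyy.
  have D : w \in common_nbhd x y1 by rewrite in_common xw.
  rewrite -aw (cardsD1 w (common_nbhd x y1)) D add1n.
  (* Trading [w] for the two new vertices [x] and [q] makes the inequality strict. *)
  have S : x |: (q |: common_nbhd x y1 :\ w) \subset common_nbhd w y1.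
    apply/subsetP=> t /setU1P[->|/setU1P[->|]].
    - by rewrite in_common ![adj _ x]adj_sym xw.
    - by rewrite in_common wq.
    rewrite in_setD1 !in_common => /and3P[tw xt y1t].
    by rewrite y1t andbT adj_sym link_dominates.
  have := subset_leq_card S; rewrite !cardsU1 !inE (negPf xq) adj_irrefl (negPf nxq).
  by rewrite !andbF.
have y1q : y1 != q by rewrite eq_sym.
have cw : corner w y1 q.
  rewrite /corner wy1 wq y1q ny1q /=; apply/forallP=> s; apply/negP.
  case/and3P=> ws y1s qs.
  have qw : adj q w by rewrite adj_sym.
  have qz : adj q z by rewrite adj_sym.
  case: (common_third y1q ny1q wz y1w qw y1z qz y1s qs) => E.
    by rewrite E adj_irrefl in ws.
  by rewrite E (negPf nwz) in ws.
(* Otherwise [t] is far from the corner [(w, y1, q)], so [a w t + l + 1 <= k], against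
   [2 * l + 1 <= a w t + k] and [l_ge]. *)
have far_q t : adj w t -> adj x t -> t != y1 -> t != y2 -> ~~ adj y1 t ->
    ~~ adj y2 t -> adj q t.
  move=> wt xt ty1 ty2 ny1t ny2t; apply/negPn/negP=> nqt.
  have tw : adj t w by rewrite adj_sym.
  have [_ ht] := far_link_sum c xt ty1 ty2 ny1t ny2t xw y1w tw.
  have tq : t != q by apply/eqP=> E; have := corner_le cw; rewrite -E; move: ht l_ge; clear; lia.
  have [_ _] := far_links cw wt ty1 tq ny1t nqt.
  by move: ht l_ge; clear; lia.
have [v [vu wv xv [vy1 vy2 ny1v ny2v]]] := second_far.
have wu : adj w u by rewrite adj_sym.
have qu := far_q u wu xu uy1 uy2 ny1u ny2u.
have qv := far_q v wv xv vy1 vy2 ny1v ny2v.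
have wx : adj w x by rewrite adj_sym.
have y1x : adj y1 x by rewrite adj_sym.
have nxq : ~~ adj x q by rewrite adj_sym (corner_sep cw wx y1x).
have qw : adj q w by rewrite adj_sym.
(* The non-adjacent [x] and [q] would share the three vertices [w], [u] and [v]. *)
case: (common_third xq nxq (adj_neq wu) xw qw xu qu xv qv) => E.
  by rewrite E adj_irrefl in wv.
by rewrite E eqxx in vu.
Qed.

End Far.

(** * Exclusion of corners, hence of induced quadrangles *)

Lemma no_corner (x y1 y2 : G) : ~~ corner x y1 y2.
Proof.
apply/negP=> c; have c' : corner x y2 y1 by rewrite cornerC.
have [u [xu uy1 uy2 ny1u ny2u]] := corner_far c.
have [[w [xw y1w uw]] [w' [xw' y2w' uw']] _] :=
  far_links c xu uy1 uy2 ny1u ny2u.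
have := corner_lt c xu uy1 uy2 ny1u ny2u xw y1w uw xw' y2w' uw'.
have := corner_lt c' xu uy2 uy1 ny2u ny1u xw' y2w' uw' xw y1w uw.
by clear; lia.
Qed.

(** The only common neighbour of [x] and [z] besides [w] is [y], which is not adjacent to [w]. *)
Lemma quadrangle_corner (w x y z : G) : adj w x -> adj x y -> adj y z ->
  adj z w -> x != z -> w != y -> ~~ adj w y -> ~~ adj x z -> corner w x z.
Proof.
move=> wx xy yz zw xz wy nwy nxz.
rewrite /corner wx [adj w z]adj_sym zw xz nxz /=; apply/forallP=> t; apply/negP.
case/and3P=> wt xt zt.
have := @common_third x z w y t xz nxz wy.
rewrite [adj x w]adj_sym [adj z y]adj_sym => -[] // E.
  by rewrite E adj_irrefl in wt.
by rewrite E (negPf nwy) in wt.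
Qed.

End CoEdgeRegular.

(* The bounds 3k/4 <= l <= k - 3 are written without division and without
   truncated subtraction. *)
Theorem theorem4p2 (n k l : nat) :
  ~ exists G : sgraph,
      [/\ strongly_co_edge_regular G n k 2 l,
          has_induced_quadrangle G,
          3 * k <= 4 * l & l + 3 <= k].
Proof.
case=> G [[[_ deg_k _ _ common2] common_sum] [w [x [y [z]]]]].
case=> uq /and4P[wx xy yz zw] nwy nxz l_ge l_le.
have /and4P[] := uq; rewrite !inE !negb_or => /and3P[_ wy _] /andP[_ xz] _ _.
have := no_corner deg_k common2 common_sum l_ge l_le w x z.
by rewrite (quadrangle_corner common2 wx xy yz zw).
Qed.
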